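(* Let $1 \le n \le 4$ and let $\sigma = \{\lambda_1, \dots, \lambda_n\} \subset \mathbb{R}$ (a finite list, repetitions allowed). Then $\sigma$ is realizable if and only if both of the following conditions hold: (i) $s_k(\sigma) := \sum_{i=1}^n \lambda_i^k \ge 0$ for every positive integer $k$; (ii) $\rho(\sigma) := \max_{1 \le i \le n} |\lambda_i| \in \sigma$. Furthermore, the realizing matrix can be taken to be permutative or a direct sum of permutative matrices; that is, if $\sigma$ is realizable, then there is an $n \times n$ entrywise nonnegative matrix with spectrum $\sigma$ that is either a permutative matrix or a direct sum (block diagonal matrix) of permutative matrices.
   Context: A set $\sigma = \{\lambda_1,\dots,\lambda_n\} \subset \mathbb{R}$ is understood as a list (multiset) of $n$ real numbers, counted with multiplicity. It is called realizable if it is the spectrum, counted with algebraic multiplicity, of some $n \times n$ matrix all of whose entries are nonnegative real numbers; such a matrix is called a realizing matrix for $\sigma$. A permutative matrix is a square matrix in which every row is a permutation of the first row, i.e. an $m \times m$ matrix whose rows are $x^\top, (P_2 x)^\top, \dots, (P_m x)^\top$ for some $x \in \mathbb{C}^m$ and some $m \times m$ permutation matrices $P_2, \dots, P_m$. In particular, every $1 \times 1$ matrix is permutative. *)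

(* Defs.v *)
From mathcomp Require Import all_boot all_order all_fingroup all_algebra.
From mathcomp Require Import reals.

Set Implicit Arguments.
Unset Strict Implicit.
Unset Printing Implicit Defensive.

Import Order.TTheory GRing.Theory Num.Theory.
Local Open Scope ring_scope.

(* The rows of A are x^T, (P_2 x)^T, ..., (P_m x)^T; the row of index 0 is the
   one for which the permutation matrix is the identity. *)
Definition permutative (F : nzRingType) (m : nat) (A : 'M[F]_m) : Prop :=
  exists (x : 'cV[F]_m) (P : 'I_m -> 'M[F]_m),
    [/\ forall i, is_perm_mx (P i),
        forall i, nat_of_ord i = 0%N -> P i = 1%:M
      & forall i, row i A = (P i *m x)^T].

(* castmx only identifies 'M_(\sum_i p i) with 'M_n. *)
Definition direct_sum_of_permutative (F : nzRingType) (n : nat)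
    (A : 'M[F]_n) : Prop :=
  exists (k : nat) (p : 'I_k -> nat) (B : forall i, 'M[F]_(p i))
         (e : (\sum_(i < k) p i)%N = n),
    [/\ forall i, (0 < p i)%N,
        forall i, permutative (B i)
      & A = castmx (e, e) (\mxdiag_(i < k) B i)].

Definition has_spectrum (F : comNzRingType) (n : nat) (A : 'M[F]_n)
    (s : n.-tuple F) : Prop :=
  char_poly A = \prod_(x <- s) ('X - x%:P).

Definition nonneg_mx (R : realType) (n : nat) (A : 'M[R]_n) : Prop :=
  forall i j, 0 <= A i j.

Definition realizing (R : realType) (n : nat) (s : n.-tuple R)
    (A : 'M[R]_n) : Prop :=
  nonneg_mx A /\ has_spectrum A s.

Definition realizable (R : realType) (n : nat) (s : n.-tuple R) : Prop :=
  exists A : 'M[R]_n, realizing s A.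

Definition moment (R : realType) (n : nat) (s : n.-tuple R) (k : nat) : R :=
  \sum_(i < n) tnth s i ^+ k.

(* As absolute values are nonnegative, the default value 0 does not affect the
   maximum when 0 < n. *)
Definition radius (R : realType) (n : nat) (s : n.-tuple R) : R :=
  \big[Num.max/0]_(i < n) `|tnth s i|.

(* Main.v *)
(* Necessity: moments are traces of powers of a nonnegative matrix.  If the
   radius rho were not in the list, then -rho would be, and the moments of
   large odd order would be negative.  Sufficiency: let rho be the radius and
   a >= b >= c the other elements.  If a <= 0, the matrix whose i-th row
   exchanges the entries 0 and i of a suitable row x works.  Otherwise the list
   splits into singletons and pairs [x; y] with |y| <= x, except when n = 4,
   b < 0 and a + b < 0, where the matrix of translations of the Klein group
   works. *)
Require Import Defs.
From mathcomp Require Import all_boot all_order all_fingroup all_algebra.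
From mathcomp Require Import reals ring lra.

Set Implicit Arguments.
Unset Strict Implicit.
Unset Printing Implicit Defensive.

Import Order.TTheory GRing.Theory Num.Theory.
Local Open Scope ring_scope.

(** * Characteristic polynomials under transposition, block sums and conjugation *)

Lemma char_poly_tr (R : comNzRingType) n (A : 'M[R]_n) :
  char_poly A^T = char_poly A.
Proof.
rewrite /char_poly -[RHS]det_tr; congr (\det _).
by rewrite /char_poly_mx linearB /= tr_scalar_mx map_trmx.
Qed.

Lemma char_poly_cast (R : comNzRingType) m n (e e' : m = n) (A : 'M[R]_m) :
  char_poly (castmx (e, e') A) = char_poly A.
Proof. by rewrite (eq_irrelevance e' e); case: n / e {e'}. Qed.

(** The size of an empty block sum is a sum that must be rewritten to 0; hence the equation on
    [n]. *)
Lemma char_poly0 (R : comNzRingType) n (A : 'M[R]_n) :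
  n = 0%N -> char_poly A = 1.
Proof. by case: n A => // A _; apply: det_mx00. Qed.

Lemma char_poly_mxdiag (R : comNzRingType) k (p : 'I_k -> nat)
    (B : forall i, 'M[R]_(p i)) :
  char_poly (\mxdiag_i B i) = \prod_i char_poly (B i).
Proof.
elim: k p B => [|k IHk] p B.
  by rewrite [RHS]big_ord0 char_poly0 // big_ord0.
rewrite mxdiag_recl char_poly_cast big_ord_recl -IHk /char_poly.
by rewrite char_block_diag_mx det_ublock.
Qed.

(** Take determinants in P (X - A) = (X - B) P and cancel det P. In this form the rows of [P] can be
    left eigenvectors. *)
Lemma char_poly_conj (F : fieldType) n (P A B : 'M[F]_n) :
  P \in unitmx -> P *m A = B *m P -> char_poly A = char_poly B.
Proof.
rewrite unitmxE unitfE => P_unit PA.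
have detP0 : \det (map_mx polyC P) != 0 by rewrite det_map_mx polyC_eq0.
apply: (mulfI detP0); rewrite -det_mulmx [RHS]mulrC -det_mulmx.
by rewrite mulmxBl mulmxBr -!map_mxM PA scalar_mxC.
Qed.

(** * Traces of powers as power sums of the roots *)

Lemma char_poly_lblock (R : comNzRingType) n (a : 'M[R]_1) (c : 'M[R]_(n, 1))
    (B : 'M[R]_n) :
  char_poly (block_mx a 0 c B) = ('X - (a 0 0)%:P) * char_poly B.
Proof.
rewrite /char_poly /char_poly_mx map_block_mx /= scalar_mx_block.
rewrite opp_block_mx add_block_mx map_mx0 oppr0 addr0 det_lblock.
by rewrite det_mx11 !mxE mulr1n.
Qed.

Lemma mxtrace_exp_lblock (R : comNzRingType) n (a : 'M[R]_1) (c : 'M[R]_(n, 1))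
    (B : 'M[R]_n) k :
  \tr (block_mx a 0 c B ^+ k) = a 0 0 ^+ k + \tr (B ^+ k).
Proof.
suff [c' ->] : exists c', block_mx a 0 c B ^+ k = block_mx (a ^+ k) 0 c' (B ^+ k).
  rewrite mxtrace_block; congr (_ + _); rewrite [a]mx11_scalar.
  by rewrite -rmorphXn /= /mxtrace big_ord1 !mxE.
elim: k => [|k [c' IHk]]; first by exists 0; rewrite !expr0 -scalar_mx_block.
exists (c *m a ^+ k + B *m c'); rewrite !exprS IHk -mulmxE mulmx_block.
by rewrite !(mul0mx, mulmx0, addr0, add0r).
Qed.

(* Deflation: an eigenvector for the first root, completed to a basis, makes
   the matrix block triangular. *)
Lemma mxtrace_exp_char_poly (F : fieldType) n (A : 'M[F]_n) (s : seq F) k :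
  char_poly A = \prod_(x <- s) ('X - x%:P) ->
  \tr (A ^+ k) = \sum_(x <- s) x ^+ k.
Proof.
elim: s n A => [|x s IHs] n A charA.
  have n0 : n = 0%N.
    by apply: succn_inj; rewrite -(size_char_poly A) charA big_nil size_poly1.
  by subst n; rewrite /mxtrace big_ord0 big_nil.
case: n A charA => [|n] A charA.
  by move/(congr1 (size : {poly F} -> nat)): charA; rewrite size_prod_XsubC size_char_poly.
have /eigenvalueP[v vA v0] : eigenvalue A x.
  by rewrite eigenvalue_root_char charA big_cons rootM root_XsubC eqxx.
pose P := row_ebase v; pose u := delta_mx 0 0 : 'rV[F]_n.+1.
have P_unit : P \in unitmx by apply: row_ebase_unit.
(* As [v] has rank 1, its rank factorization makes it a nonzero multiple of the first row of [P]. *)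
have [c c0 vE] : exists2 c, c != 0 & v = c *: (u *m P).
  exists (col_ebase v 0 0).
    by have := col_ebase_unit v; rewrite unitmxE det_mx11 unitfE.
  rewrite -[LHS](mulmx_ebase v) rank_rV v0 [col_ebase v]mx11_scalar mxE mulr1n.
  rewrite mul_scalar_mx -scalemxAl; congr (_ *: (_ *m _)).
  by apply/rowP=> j; rewrite !mxE /= andbT eq_sym.
pose B := P *m A *m invmx P : 'M_(1 + n).
have PA : P *m A = B *m P by rewrite mulmxKV.
have uB : u *m B = x *: u.
  move: vA; rewrite vE -scalemxAl scalerA mulrC -scalerA => /(scalerI c0) uPA.
  by rewrite !mulmxA uPA -scalemxAl mulmxK.
clearbody B; have B0 j : B 0 j = x *+ (j == 0).
  by move/rowP/(_ j): uB; rewrite -rowE !mxE mulr_natr.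
have lshift0 : lshift n (0 : 'I_1) = 0 by apply: val_inj.
have BE : B = block_mx x%:M 0 (dlsubmx B) (drsubmx B).
  rewrite -{1}[B]submxK; congr block_mx; apply/rowP=> j; rewrite !mxE lshift0 B0 //.
  by rewrite (ord1 j) lshift0.
have trE : \tr (A ^+ k) = \tr (B ^+ k).
  suff PAk : P *m A ^+ k = B ^+ k *m P.
    by rewrite -[B ^+ k](mulmxK P_unit) -PAk mxtrace_mulC mulmxA mulVmx ?mul1mx.
  elim: (k) => [|m IHm]; first by rewrite !expr0 mulmx1 mul1mx.
  by rewrite exprSr -mulmxE mulmxA IHm -mulmxA PA mulmxA mulmxE -exprSr.
rewrite trE BE mxtrace_exp_lblock mxE eqxx mulr1n big_cons; congr (_ + _).
(* Cancelling X - x leaves the lower right block with the product over the remaining roots. *)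
apply: IHs; apply: (@mulfI _ ('X - x%:P)); first by rewrite polyXsubC_eq0.
move: charA; rewrite big_cons (char_poly_conj P_unit PA) {1}BE => <-.
by rewrite (char_poly_lblock x%:M) mxE eqxx mulr1n.
Qed.

(** * Necessity of the two conditions *)

Lemma mxtrace_exp_ge0 (R : numDomainType) n (A : 'M[R]_n) k :
  (forall i j, 0 <= A i j) -> 0 <= \tr (A ^+ k).
Proof.
move=> A_ge0; suff Ak_ge0 i j : 0 <= (A ^+ k) i j by apply: sumr_ge0.
elim: k i j => [|k IHk] i j; first by rewrite expr0 mxE mulrn_wge0 ?ler01.
by rewrite exprS -mulmxE mxE; apply: sumr_ge0 => l _; apply: mulr_ge0.
Qed.

(** For r > 0, Bernoulli's inequality gives q^k >= r^(k-1) (r + k (q - r)), and the last factor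
    exceeds c r for large k. Below, [c] is the length of the list and [q] its radius. *)
Lemma exp_odd_dominates (R : archiRealFieldType) (r q c : R) :
  0 <= c -> 0 <= r -> r < q -> exists2 k, odd k & c * r ^+ k < q ^+ k.
Proof.
move=> c_ge0 r_ge0 lt_rq; have q_gt0 := le_lt_trans r_ge0 lt_rq.
have bernoulli m : r ^+ m * (r + m.+1%:R * (q - r)) <= q ^+ m.+1.
  elim: m => [|m IHm]; first by rewrite expr0 expr1; lra.
  rewrite [in leRHS]exprSr; apply: le_trans (ler_wpM2r (ltW q_gt0) IHm).
  rewrite exprSr -!mulrA ler_wpM2l ?exprn_ge0 //.
  have m_ge0 : 0 <= m.+1%:R :> R by apply: ler0n.
  rewrite -[m.+2]addn1 natrD; have := mulr_ge0 m_ge0 (sqr_ge0 (q - r)).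
  by rewrite expr2; lra.
have [r0|r_neq0] := eqVneq r 0.
  by exists 1%N; rewrite // !expr1 r0 mulr0.
pose m := Num.bound (c * r / (q - r)); exists m.*2.+1; first by rewrite /= odd_double.
apply: lt_le_trans (bernoulli m.*2).
have r_gt0 : 0 < r by rewrite lt_def r_neq0.
rewrite exprS mulrA mulrC ltr_pM2l ?exprn_gt0 //.
have : c * r / (q - r) < m%:R.
  by apply: archi_boundP; rewrite divr_ge0 ?mulr_ge0 // subr_ge0 ltW.
rewrite ltr_pdivrMr ?subr_gt0 // => /lt_le_trans; apply.
rewrite ler_wpDl // ler_pM2r ?subr_gt0 // ler_nat -addnn.
by rewrite -addnS leq_addr.
Qed.

Lemma le_radius (R : realType) n (s : n.-tuple R) x :
  x \in s -> `|x| <= radius s.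
Proof. by case/tnthP=> i ->; apply: (le_bigmax _ (fun i => `|tnth s i|)). Qed.

Lemma radius_mem (R : realType) n (s : n.-tuple R) :
  (0 < n)%N -> (forall k, (0 < k)%N -> 0 <= moment s k) -> radius s \in s.
Proof.
move=> n_gt0 s_ge0; apply: contraT => rho_notin.
have [i _ rhoE] : {i : 'I_n | i \in predT & radius s = `|tnth s i|}.
  by apply: (eq_bigmax (Ordinal n_gt0)).
have [si_ge0|si_lt0] := lerP 0 (tnth s i).
  by rewrite rhoE ger0_norm // mem_tnth in rho_notin.
(* The default 0 keeps [r] nonnegative; [r] stays below the radius because no element equals the
   radius. *)
rewrite ltr0_norm // in rhoE; pose r := \big[Num.max/0]_(j < n) tnth s j.
have s_le_r j : tnth s j <= r by apply: (le_bigmax _ (tnth s)).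
have r_ge0 : 0 <= r by apply: bigmax_ge_id.
have r_lt : r < radius s.
  apply: bigmax_lt => [|j _]; first by rewrite rhoE oppr_gt0.
  rewrite lt_neqAle (le_trans (ler_norm _) (le_radius (mem_tnth j s))) andbT.
  by apply: contraNneq rho_notin => <-; apply: mem_tnth.
have [k k_odd] := exp_odd_dominates (ler0n R n) r_ge0 r_lt.
(* The term (-rho)^k cancels rho^k; as k is odd, every other element contributes at most r^k. *)
suff : radius s ^+ k + moment s k <= n%:R * r ^+ k.
  by have := s_ge0 k (odd_gt0 k_odd); lra.
rewrite -[n in n%:R]card_ord mulr_natl -sumr_const /moment.
rewrite (bigD1 i) //= [leRHS](bigD1 i) //= addrA rhoE exprNn -signr_odd k_odd.
rewrite mulN1r addNr lerD ?exprn_ge0 //; apply: ler_sum => j _.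
have [sj_ge0|sj_lt0] := lerP 0 (tnth s j); first by rewrite lerXn2r ?nnegrE.
by apply: (@le_trans _ _ 0); rewrite ?exprn_ge0 // exprn_odd_le0 // ltW.
Qed.

(** * Permutative matrices with prescribed spectrum *)

Lemma permutative_rows (F : nzRingType) m (x : 'rV[F]_m)
    (f : 'I_m -> 'I_m -> 'I_m) :
  (forall i, injective (f i)) -> (forall i : 'I_m, i = 0%N :> nat -> f i =1 id) ->
  permutative (\matrix_(i, j) x 0 (f i j)).
Proof.
move=> f_inj f0; exists x^T, (fun i => perm_mx (perm (@f_inj i))); split=> i.
- exact: perm_mx_is_perm.
- move=> i0; rewrite -perm_mx1; congr perm_mx.
  by apply/permP=> j; rewrite permE perm1 f0.
- by apply/rowP=> j; rewrite -row_permE !mxE permE.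
Qed.

(** Lists rather than tuples, so that a spectrum can be cut into blocks of different sizes. *)
Definition permutatively_realizable (R : realType) (l : seq R) : Prop :=
  exists A : 'M[R]_(size l),
    [/\ permutative A, nonneg_mx A & has_spectrum A (in_tuple l)].

(* The rows e_0 - e_i (i > 0) of P are left eigenvectors, so P makes the matrix
   triangular. *)
Lemma char_poly_swap (F : fieldType) n (x : 'rV[F]_n.+1) :
  char_poly (\matrix_(i, j) x 0 (tperm 0 i j)) =
  ('X - (\sum_j x 0 j)%:P) * \prod_(i < n) ('X - (x 0 0 - x 0 (lift 0 i))%:P).
Proof.
set A := \matrix_(i, j) _.
pose P := \matrix_(i, j < n.+1) ((j == 0)%:R - ((i != 0) && (j == i))%:R) : 'M[F]_n.+1.
(* [U] is the action of [A] on the rows of [P]: e_0 A = (sum_j x_j) e_0 - sum_(j > 0) x_j (e_0 -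
   e_j), and (e_0 - e_i) A = (x_0 - x_i) (e_0 - e_i). *)
pose U := \matrix_(i, j < n.+1)
  (if i == 0 then if j == 0 then \sum_j x 0 j else - x 0 j
   else (x 0 0 - x 0 i) *+ (i == j)).
have rowP0 i : row i P = 'e_0 - 'e_i *+ (i != 0).
  by apply/rowP=> j; rewrite !(mxE, mulmxnE) eqxx; case: (i != 0).
have PP : P *m P = 1%:M.
  apply/row_matrixP=> i; rewrite row_mul row1 [row i P]rowP0.
  have [->|i0] := eqVneq i 0.
    by rewrite mulr0n subr0 -rowE rowP0 eqxx mulr0n subr0.
  by rewrite mulr1n mulmxBl -!rowE !rowP0 eqxx i0 mulr0n mulr1n subr0 subKr.
have PA : P *m A = U *m P.
  apply/row_matrixP=> i; rewrite !row_mul rowP0.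
  have [->|i0] := eqVneq i 0.
    rewrite mulr0n subr0 -rowE; apply/rowP=> j; rewrite !mxE tperm1 perm1.
    rewrite big_ord_recl !mxE /= subr0.
    under [X in _ + X]eq_bigr => k _ do rewrite !mxE /=.
    case: (unliftP 0 j) => [k ->|->].
      rewrite (bigD1 k) //= eqxx mulr0 add0r sub0r mulrN1 opprK big1 ?addr0 // => l.
      by rewrite (inj_eq lift_inj) eq_sym => /negPf ->; rewrite subr0 mulr0.
    rewrite eqxx mulr1 big_ord_recl -addrA -big_split big1 ?addr0 // => l _.
    by rewrite /= subr0 mulr1 subrr.
  have -> : row i U = (x 0 0 - x 0 i) *: 'e_i.
    apply/rowP=> j; rewrite !mxE (negPf i0) eqxx /= eq_sym.
    by case: (j == i); rewrite ?mulr1 ?mulr0.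
  rewrite mulr1n mulmxBl -scalemxAl -!rowE rowP0 i0 mulr1n.
  apply/rowP=> j; rewrite !mxE tperm1 perm1 eqxx /=.
  case: tpermP => [->|->|/eqP/negPf -> /eqP/negPf ->].
  - by rewrite eqxx eq_sym (negPf i0) subr0 mulr1.
  - by rewrite eqxx (negPf i0) sub0r mulrN1 opprB.
  - by rewrite !subrr mulr0.
rewrite (char_poly_conj _ PA); last by case/mulmx1_unit: PP.
rewrite -char_poly_tr char_poly_trig.
  rewrite big_ord_recl !mxE eqxx; congr (_ * _); apply: eq_bigr => i _.
  by rewrite !mxE eqxx.
apply/is_trig_mxP=> i j lt_ij; rewrite !mxE; case: eqP => [j0|_].
  by rewrite j0 in lt_ij.
by case: eqP => // ji; rewrite ji ltnn in lt_ij.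
Qed.

(** By [char_poly_swap] the row x should have sum [a] and differences x_0 - x_i = t_i. This forces
    x_0 to be the mean [m] of the list and x_i = m - t_i; the hypotheses make these entries
    nonnegative. *)
Lemma suleimanova_realizable (R : realType) (a : R) (t : seq R) :
  let m := (\sum_(x <- a :: t) x) / (size t).+1%:R in
  0 <= m -> {in t, forall x, x <= m} -> permutatively_realizable (a :: t).
Proof.
move=> m m_ge0 t_le.
pose x := \row_(i < (size t).+1) (if i == 0 then m else m - (a :: t)`_i).
exists (\matrix_(i, j) x 0 (tperm 0 i j)); split.
- apply: permutative_rows => [i|i i0]; first exact: perm_inj.
  by move=> j; have -> : i = 0 by [apply: val_inj]; rewrite tperm1 perm1.
- move=> i j; rewrite !mxE; case: eqP => // /eqP; case: (tperm 0 i j) => -[|k] //= lt_k _.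
  by rewrite subr_ge0 t_le // mem_nth.
- rewrite /has_spectrum char_poly_swap /= big_cons.
  have size0 : (size t).+1%:R != 0 :> R by rewrite pnatr_eq0.
  congr (('X - _%:P) * _).
    rewrite big_ord_recl mxE eqxx.
    under eq_bigr do rewrite mxE /=.
    rewrite sumrB sumr_const card_ord.
    have -> : \sum_(i < size t) t`_i = \sum_(y <- t) y.
      by rewrite [RHS](big_nth 0) big_mkord.
    by rewrite addrA -mulrS -[m *+ _]mulr_natr divfK // big_cons addrK.
  rewrite (big_nth 0) big_mkord; apply: eq_bigr => i _.
  by rewrite !mxE /= subKr.
Qed.

(** Characters diagonalize the translation matrices of the Klein group, so the first row is the
    inverse Fourier transform of the spectrum. The hypotheses say that its four entries are
    nonnegative. *)
Lemma klein_realizable (R : realType) (a b c d : R) :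
  0 <= a + b + c + d -> 0 <= a - b + c - d -> 0 <= a + b - c - d ->
  0 <= a - b - c + d -> permutatively_realizable [:: a; b; c; d].
Proof.
move=> h0 h1 h2 h3.
(* The character table of the Klein group, whose addition table is f. *)
pose L := \matrix_(i, j < 4)
  (nth [::] [:: [:: 1;  1;  1;  1];
                [:: 1; -1;  1; -1];
                [:: 1;  1; -1; -1];
                [:: 1; -1; -1;  1]] i)`_j : 'M[R]_4.
pose x := \row_(j < 4) [:: (a + b + c + d) / 4; (a - b + c - d) / 4;
                           (a + b - c - d) / 4; (a - b - c + d) / 4]`_j.
(* Modulo 4, this is the bitwise exclusive or of [i] and [j]. *)
pose f (i j : 'I_4) := if odd i then i - j else i + j.
exists (\matrix_(i, j) x 0 (f i j)); split.
- apply: permutative_rows => [i|i i0] j.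
    by move=> k; rewrite /f; case: ifP => _ /addrI // /oppr_inj.
  by rewrite /f i0 /=; have -> : i = 0 by [apply: val_inj]; rewrite add0r.
- by move=> i j; rewrite !mxE; case: (f i j) => -[|[|[|[|]]]] //= lt_4; lra.
have LL : L *m (4^-1 *: L) = 1%:M.
  apply/matrixP=> i j; rewrite !mxE !big_ord_recr big_ord0 !mxE /=.
  by case: i j => -[|[|[|[|]]]] //= ? [[|[|[|[|]]]]] //= ?; field.
have LA : L *m (\matrix_(i, j) x 0 (f i j)) =
    diag_mx (\row_i [:: a; b; c; d]`_i) *m L.
  apply/matrixP=> i j; rewrite mul_diag_mx !mxE !big_ord_recr big_ord0 !mxE /f /=.
  by case: i j => -[|[|[|[|]]]] //= ? [[|[|[|[|]]]]] //= ?; field.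
rewrite /has_spectrum (char_poly_conj _ LA); last by case/mulmx1_unit: LL.
rewrite char_poly_trig ?diag_mx_is_trig // [RHS](big_nth 0) big_mkord /=.
by apply: eq_bigr => i _; rewrite !mxE eqxx.
Qed.

(** * Direct sums and the splitting of the list *)

Lemma direct_sum_realizing (R : realType) n (s : n.-tuple R) (ll : seq (seq R)) :
  (forall l, l \in ll -> (0 < size l)%N /\ permutatively_realizable l) ->
  perm_eq (flatten ll) s ->
  exists A : 'M[R]_n, realizing s A /\ direct_sum_of_permutative A.
Proof.
move=> ll_real perm_s; pose p (i : 'I_(size ll)) := size (tnth (in_tuple ll) i).
have /fin_all_exists[B B_real] (i : 'I_(size ll)) : exists B : 'M[R]_(p i),
    [/\ permutative B, nonneg_mx B
      & has_spectrum B (in_tuple (tnth (in_tuple ll) i))].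
  by case: (ll_real _ (mem_tnth i (in_tuple ll))).
have e : (\sum_i p i)%N = n.
  rewrite -(size_tuple s) -(perm_size perm_s) size_flatten sumnE big_map.
  by rewrite [RHS]big_tnth.
exists (castmx (e, e) (\mxdiag_i B i)); split; last first.
  exists (size ll), p, B, e; split=> // i; last by case: (B_real i).
  by case: (ll_real _ (mem_tnth i (in_tuple ll))).
have B_ge0 i : nonneg_mx (B i) by case: (B_real i).
split.
  move=> i j; rewrite castmxE !mxE.
  (* Entries of a diagonal block are read through [conform_mx], which disappears once the two block
     indices are identified. *)
  case: eqP => [eq_ij|_]; last by rewrite mxE.
  move: (tagnat.sig2 (cast_ord _ j)); rewrite -eq_ij => j'.
  by rewrite conform_mx_id; apply: B_ge0.
rewrite /has_spectrum char_poly_cast char_poly_mxdiag -(perm_big _ perm_s) /=.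
rewrite big_flatten [RHS]big_tnth; apply: eq_bigr => i _.
by case: (B_real i) => _ _ ->.
Qed.

Lemma decomposition_realizing (R : realType) n (s : n.-tuple R) :
  (n <= 4)%N -> 0 <= \sum_(x <- s) x -> radius s \in s ->
  exists A : 'M[R]_n, realizing s A /\ direct_sum_of_permutative A.
Proof.
move=> n_le4 sum_ge0 rho_in.
set q := radius s in rho_in.
have le_rho x : x \in s -> `|x| <= q by apply: le_radius.
pose t := sort >=%O (rem q s).
have perm_t : perm_eq (q :: t) s.
  by rewrite perm_sym (perm_trans (perm_to_rem rho_in)) // perm_cons perm_sym perm_sort.
have t_sorted : sorted >=%O t by apply: sort_sorted; apply: ge_total.
have t_bound : {in t, forall x, - q <= x <= q}.
  move=> x xt; rewrite -ler_norml le_rho // -(perm_mem perm_t) inE xt orbT //.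
have size_t : (size t < 4)%N.
  by move: (perm_size perm_t); rewrite /= size_tuple => ->.
rewrite -(perm_big _ perm_t) /= in sum_ge0.
have pair (x y : R) : 0 <= x + y -> y <= x -> permutatively_realizable [:: x; y].
  move=> xy_ge0 le_yx; apply: suleimanova_realizable.
    by rewrite !big_cons big_nil addr0 divr_ge0.
  move=> z; rewrite inE => /eqP ->; rewrite !big_cons big_nil /=; lra.
have single (x : R) : 0 <= x -> permutatively_realizable [:: x].
  by move=> x_ge0; apply: suleimanova_realizable; rewrite // big_seq1 divr_ge0.
clearbody t q.
(* The default 0 puts the one-element list in the first case, where every element of [t] is at most
   0, hence at most the mean. *)
have [head_le0|] := lerP (head 0 t) 0.
  apply: (@direct_sum_realizing _ _ _ [:: q :: t]); last by rewrite /= cats0.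
  move=> l; rewrite inE => /eqP ->; split=> //; apply: suleimanova_realizable.
    by rewrite divr_ge0.
  move=> x xt; apply: (@le_trans _ _ 0); last by rewrite divr_ge0.
  case: t xt t_sorted head_le0 {perm_t t_bound size_t sum_ge0} => //= a t.
  rewrite inE => /predU1P[-> //|xt] /(order_path_min ge_trans)/allP/(_ x xt).
  exact: le_trans.
have {}t_bound x : x \in t -> 0 <= q + x /\ x <= q.
  by move=> /t_bound; lra.
have q_ge0 : 0 <= q by move: rho_in => /le_rho; apply: le_trans.
case: t => [|a [|b [|c [|d t]]]] //= in perm_t t_sorted t_bound size_t sum_ge0 *.
- by rewrite ltxx.
- move=> a_gt0.
  apply: (@direct_sum_realizing _ _ _ [:: [:: q]; [:: a]]) => // l.
  by rewrite !inE => /orP[] /eqP ->; split=> //; apply: single; lra.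
(* The smallest element may be negative; it is paired with [q], which compensates it. *)
- move=> a_gt0; have [qb_ge0 le_bq] := t_bound b ltac:(by rewrite !inE eqxx orbT).
  apply: (@direct_sum_realizing _ _ _ [:: [:: q; b]; [:: a]]) => [l|].
    rewrite !inE => /orP[] /eqP ->; split=> //; first exact: pair.
    by apply: single; lra.
  by rewrite -(permPr perm_t) /= perm_cons (perm_catC [:: b]).
move=> a_gt0; have [qc_ge0 le_cq] := t_bound c ltac:(by rewrite !inE eqxx !orbT).
have [_ le_aq] := t_bound a ltac:(by rewrite !inE eqxx).
have /and3P[le_ba le_cb _] := t_sorted.
have [b_ge0|b_lt0] := lerP 0 b.
  apply: (@direct_sum_realizing _ _ _ [:: [:: q; c]; [:: a]; [:: b]]) => [l|].
    rewrite !inE => /or3P[] /eqP ->; split=> //; first exact: pair.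
      by apply: single; lra.
    exact: single.
  by rewrite -(permPr perm_t) /= perm_cons (perm_catC [:: c]).
have [ab_ge0|ab_lt0] := lerP 0 (a + b).
  apply: (@direct_sum_realizing _ _ _ [:: [:: q; c]; [:: a; b]]) => [l|].
    by rewrite !inE => /orP[] /eqP ->; split=> //; apply: pair.
  by rewrite -(permPr perm_t) /= perm_cons (perm_catC [:: c]).
(* Besides the sum, the Klein conditions are (q - a) + (b - c) >= 0, (q - c) + (a - b) >= 0 and (q +
   c) - (a + b) >= 0; the last one uses a + b < 0. *)
apply: (@direct_sum_realizing _ _ _ [:: [:: q; a; b; c]]) => // l.
rewrite inE => /eqP ->; split=> //; rewrite !big_cons big_nil in sum_ge0.
apply: klein_realizable; lra.
Qed.

Theorem theorem4p1 (R : realType) (n : nat) (hn : (1 <= n <= 4)%N)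
    (s : n.-tuple R) :
  (realizable s <->
     (forall k : nat, (0 < k)%N -> 0 <= moment s k) /\ radius s \in s) /\
  (realizable s ->
     exists A : 'M[R]_n,
       realizing s A /\ (permutative A \/ direct_sum_of_permutative A)).
Proof.
have /andP[n_gt0 n_le4] := hn.
have necessary : realizable s ->
    (forall k, (0 < k)%N -> 0 <= moment s k) /\ radius s \in s.
  move=> [A [A_ge0 spec_A]]; suff s_ge0 k : (0 < k)%N -> 0 <= moment s k.
    by split=> //; apply: radius_mem.
  move=> _; rewrite /moment -(big_tuple _ _ s predT (fun x => x ^+ k)).
  by rewrite -(mxtrace_exp_char_poly k spec_A) mxtrace_exp_ge0.
have sufficient : (forall k, (0 < k)%N -> 0 <= moment s k) /\ radius s \in s ->
    exists A : 'M[R]_n, realizing s A /\ direct_sum_of_permutative A.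
  move=> [/(_ 1%N isT) s_ge0 rho_in]; apply: decomposition_realizing => //.
  by rewrite big_tuple; apply: le_trans s_ge0 _; apply: ler_sum => i _; rewrite expr1.
split; first split=> // /sufficient[A [A_real _]]; first by exists A.
(* A single permutative block is a direct sum with one summand, so the second alternative covers all
   cases. *)
by move=> /necessary/sufficient[A [A_real A_sum]]; exists A; split=> //; right.
Qed.
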